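(* For all integers $n\ge 2$: $f(n,2,1)=n$, $f(n,2,2)=\lceil 3n/2\rceil$, $f(n,2,3)=\lceil 9n/4\rceil$, and $f(n,2,4)=3n$.
   Context: For integers $d\ge 1$, $n\ge 1$, the triangular grid is $T_d(n)=\{(x_1,\dots,x_d)\in\mathbb{Z}_{\ge 0}^d : x_1+\dots+x_d\le n-1\}$. A $k$-cover of $T_d(n)$ is a finite multiset of affine hyperplanes in $\mathbb{R}^d$ such that every point of $T_d(n)$ lies in at least $k$ of them (counted with multiplicity). $f(n,d,k)$ is the minimum cardinality (with multiplicity) of a $k$-cover of $T_d(n)$, and $f(n,d)=f(n,d,1)$. For $d=2$ hyperplanes are lines. *)

(* Defs.v *)
From HB Require Import structures.
From mathcomp Require Import all_boot all_order all_algebra.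
From mathcomp Require Import boolp.
From mathcomp Require Import Rstruct.
From Stdlib Require Import Reals.
Notation R := Rdefinitions.R.
Set Implicit Arguments. Unset Strict Implicit. Unset Printing Implicit Defensive.
Import Order.TTheory GRing.Theory Num.Theory.
Definition in_grid (n d : nat) (x : 'I_d -> nat) : Prop :=
  \sum_(i < d) x i < n.

Local Open Scope ring_scope.

(* An affine hyperplane in R^d is given by a pair (a, b) with a : 'I_d -> R
   nonzero; it is the set {x | sum_i a_i x_i = b}. *)
Definition hyperplane (d : nat) : Type := (('I_d -> R) * R)%type.

Definition nondegenerate (d : nat) (H : hyperplane d) : Prop :=
  exists i : 'I_d, H.1 i != 0.

Definition on_hyperplane (d : nat) (H : hyperplane d) (x : 'I_d -> nat) : bool :=
  \sum_(i < d) H.1 i * (x i)%:R == H.2.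

Definition is_kcover (n d k : nat) (L : seq (hyperplane d)) : Prop :=
  (forall H, H \in L -> nondegenerate H) /\
  forall x : 'I_d -> nat, @in_grid n d x ->
    leq k (count (fun H => on_hyperplane H x) L).

Definition has_kcover_of_size (n d k m : nat) : Prop :=
  exists L : seq (hyperplane d), size L = m /\ @is_kcover n d k L.

(* f(n,d,k): minimum cardinality of a k-cover of T_d(n)
   (defaults to 0 if no k-cover exists, which never happens for d >= 1). *)
Definition f (n d k : nat) : nat :=
  match pselect (exists m, `[< has_kcover_of_size n d k m >]) with
  | left H => ex_minn H
  | right _ => 0%nat
  end.

(* Main.v *)
Require Import Defs.
From mathcomp Require Import all_boot all_order all_algebra.
From mathcomp Require Import boolp Rstruct ring lra zify.
Require Import Defs.

(** The lower bounds are linear programming duality: for a multiset [W] of grid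
points, [k |W|] is at most the sum over the lines of the cover of the number of
points of [W] they contain. A line that is not a side of a triangle meets its
boundary in at most two lattice points, so sets of boundary points are good
choices of [W], once the multiplicities of the sides are treated separately. A
side of the grid used [p] times forces [p + (k - p) n] lines, and one that is
used often can be peeled off by induction on [n].

For [k = 4] this leaves the case of three sides used exactly twice, where the
non-vertex boundary points give [2N >= 6n]; doubling a 2-cover gives the case
[k = 2]. For [k = 3], let [a], [b], [c] be the numbers of consecutive lines
[x = 0, 1, ..], [y = 0, 1, ..], [z = 0, 1, ..] (with [z = n-1-x-y]) used at
least twice, and [s = a + b + c]. If [a, b, c > 0] and [4s >= 3n], the sides of
the grid outside these strips suffice. If [a, b, c > 0] and [4s < 3n], a
weighting of the boundary of the inner triangle [x >= a, y >= b, z >= c] and of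
the sides of the grid gives [8N >= 18n], because a line through a vertex and a
further boundary point of the inner triangle misses many of the other points.
If [a = 0], the boundary of the inner triangle, that of the grid or, for small
[n], a single point suffices. The upper bounds use only lines parallel to the sides. *)

Set Implicit Arguments. Unset Strict Implicit. Unset Printing Implicit Defensive.
Import Order.TTheory GRing.Theory Num.Theory.
Local Open Scope nat_scope.

(** * Lines of the plane and their normal equations *)

Notation line K := (K * K * K)%type.

Definition inc (K : realFieldType) (l : line K) (p : nat * nat) : bool :=
  (l.1.1 * p.1%:R + l.1.2 * p.2%:R == l.2)%R.

(* Each line has a unique normal equation, so multiplicities are plain
   [count_mem]s. *)
Definition normal (K : realFieldType) (l : line K) : bool :=
  ((l.1.1 == 1) || (l.1.1 == 0) && (l.1.2 == 1))%R.

Definition normalize (K : realFieldType) (l : line K) : line K :=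
  (if l.1.1 == 0 then (0, 1, l.2 / l.1.2)
   else (1, l.1.2 / l.1.1, l.2 / l.1.1))%R.

Definition xline (K : realFieldType) (i : nat) : line K := (1, 0, i%:R)%R.
Definition yline (K : realFieldType) (j : nat) : line K := (0, 1, j%:R)%R.
Definition dline (K : realFieldType) (e : nat) : line K := (1, 1, e%:R)%R.
Arguments inc {K} l p.
Arguments xline {K} i.
Arguments yline {K} j.
Arguments dline {K} e.

Lemma normal_normalize (K : realFieldType) (l : line K) : normal (normalize l).
Proof. by rewrite /normal /normalize; case: ifP => _ /=; rewrite ?eqxx ?orbT. Qed.

Lemma inc_normalize (K : realFieldType) (l : line K) p :
  (l.1.1 != 0)%R || (l.1.2 != 0)%R -> inc (normalize l) p = inc l p.
Proof.
case: l => [[A B] C] /=; rewrite /inc /normalize /=.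
case: eqP => [->|/eqP A0 _] /=.
  move=> B0; rewrite !mul0r !add0r mul1r.
  by apply/eqP/eqP => [->|<-]; field.
apply/eqP/eqP => [H|<-]; last by field.
have -> : (A * p.1%:R + B * p.2%:R = A * (1 * p.1%:R + B / A * p.2%:R))%R by field.
by rewrite H; field.
Qed.

Lemma inc_xline (K : realFieldType) i p : inc (@xline K i) p = (p.1 == i).
Proof. by rewrite /inc /= mul1r mul0r addr0 eqr_nat. Qed.

Lemma inc_yline (K : realFieldType) j p : inc (@yline K j) p = (p.2 == j).
Proof. by rewrite /inc /= mul1r mul0r add0r eqr_nat. Qed.

Lemma inc_dline (K : realFieldType) e p : inc (@dline K e) p = (p.1 + p.2 == e).
Proof. by rewrite /inc /= !mul1r -natrD eqr_nat. Qed.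

Lemma xline_inj (K : realFieldType) : injective (@xline K).
Proof. by move=> i j [] /eqP; rewrite eqr_nat => /eqP. Qed.

Lemma yline_inj (K : realFieldType) : injective (@yline K).
Proof. by move=> i j [] /eqP; rewrite eqr_nat => /eqP. Qed.

Lemma dline_inj (K : realFieldType) : injective (@dline K).
Proof. by move=> i j [] /eqP; rewrite eqr_nat => /eqP. Qed.

Lemma xline_eq_yline (K : realFieldType) i j : (@xline K i == yline j) = false.
Proof. by rewrite /xline /yline !xpair_eqE oner_eq0. Qed.

Lemma xline_eq_dline (K : realFieldType) i j : (@xline K i == dline j) = false.
Proof. by rewrite /xline /dline !xpair_eqE eq_sym oner_eq0 andbF. Qed.

Lemma yline_eq_dline (K : realFieldType) i j : (@yline K i == dline j) = false.
Proof. by rewrite /yline /dline !xpair_eqE eq_sym oner_eq0. Qed.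

Lemma xline_through2 (K : realFieldType) (l : line K) i p q :
  normal l -> inc l p -> inc l q -> p != q -> p.1 = i -> q.1 = i -> l = xline i.
Proof.
case: l p q => [[A B] C] [x y] [x' y'] /=; rewrite /inc /normal /=.
move=> N /eqP Hp /eqP Hq ne Ex Ex'; subst x x'.
have ny : (y%:R - y'%:R != 0 :> K)%R.
  by rewrite subr_eq0 eqr_nat; apply: contraNneq ne => ->.
have : (B * (y%:R - y'%:R) = 0)%R by rewrite mulrBr; lra.
move/eqP; rewrite mulf_eq0 (negPf ny) orbF => /eqP B0; subst B.
move: N; rewrite [(0 == 1)%R]eq_sym oner_eq0 andbF orbF => /eqP A1; subst A.
by rewrite /xline -Hp mul0r addr0 mul1r.
Qed.

Lemma yline_through2 (K : realFieldType) (l : line K) j p q :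
  normal l -> inc l p -> inc l q -> p != q -> p.2 = j -> q.2 = j -> l = yline j.
Proof.
case: l p q => [[A B] C] [x y] [x' y'] /=; rewrite /inc /normal /=.
move=> N /eqP Hp /eqP Hq ne Ex Ex'; subst y y'.
have ny : (x%:R - x'%:R != 0 :> K)%R.
  by rewrite subr_eq0 eqr_nat; apply: contraNneq ne => ->.
have : (A * (x%:R - x'%:R) = 0)%R by rewrite mulrBr; lra.
move/eqP; rewrite mulf_eq0 (negPf ny) orbF => /eqP A0; subst A.
move: N; rewrite [(0 == 1)%R]eq_sym oner_eq0 eqxx /= => /eqP B1; subst B.
by rewrite /yline -Hp mul0r add0r mul1r.
Qed.

Lemma dline_through2 (K : realFieldType) (l : line K) e p q :
  normal l -> inc l p -> inc l q -> p != q ->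
  p.1 + p.2 = e -> q.1 + q.2 = e -> l = dline e.
Proof.
case: l p q => [[A B] C] [x y] [x' y'] /=; rewrite /inc /normal /=.
move=> N /eqP Hp /eqP Hq ne Ex Ex'.
have nx : (x%:R - x'%:R != 0 :> K)%R.
  rewrite subr_eq0 eqr_nat; apply: contraNneq ne => xx'.
  have -> : y = y' by lia.
  by rewrite xx'.
have E : (x%:R + y%:R = e%:R :> K)%R by rewrite -natrD Ex.
have E' : (x'%:R + y'%:R = e%:R :> K)%R by rewrite -natrD Ex'.
have Ey : (y%:R = e%:R - x%:R :> K)%R by lra.
have Ey' : (y'%:R = e%:R - x'%:R :> K)%R by lra.
have : ((A - B) * (x%:R - x'%:R) = 0)%R.
  by move: Hp Hq; rewrite Ey Ey' => <- Hq; rewrite -[RHS](subrr (B * e%:R)%R); lra.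
move/eqP; rewrite mulf_eq0 (negPf nx) orbF subr_eq0 => /eqP AB; subst B.
have A1 : (A = 1)%R by case/orP: N => [/eqP//|/andP[_ /eqP]].
by rewrite /dline -Hp A1 !mul1r E.
Qed.

Lemma collinear (K : realFieldType) (l : line K) p q r :
  normal l -> inc l p -> inc l q -> inc l r ->
  ((q.1%:R - p.1%:R) * (r.2%:R - p.2%:R) =
   (r.1%:R - p.1%:R) * (q.2%:R - p.2%:R) :> K)%R.
Proof.
case: l p q r => [[A B] C] [x y] [x' y'] [x'' y''] /=; rewrite /inc /normal /=.
case/orP => [/eqP->|/andP[/eqP-> /eqP->]] /eqP Hp /eqP Hq /eqP Hr; last first.
  have -> : (y''%:R = y%:R :> K)%R by lra.
  have -> : (y'%:R = y%:R :> K)%R by lra.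
  ring.
have -> : (x''%:R = C - B * y''%:R :> K)%R by lra.
have -> : (x'%:R = C - B * y'%:R :> K)%R by lra.
have -> : (x%:R = C - B * y%:R :> K)%R by lra.
ring.
Qed.

(** * Lines and triangles *)

Definition on_triangle i j e (p : nat * nat) : bool :=
  [&& i <= p.1, j <= p.2, p.1 + p.2 <= e &
      [|| p.1 == i, p.2 == j | p.1 + p.2 == e]].

(* An affine function that is nonnegative at the two outer points of a line
   and vanishes at the middle one vanishes on the whole line. *)
Lemma middle_on_side (K : realFieldType) (l : line K) i j e p q r
    (t := fun p : nat * nat => (l.1.2 * p.1%:R - l.1.1 * p.2%:R)%R) :
  normal l -> inc l p -> inc l q -> inc l r ->
  on_triangle i j e p -> on_triangle i j e q -> on_triangle i j e r ->
  (t p < t q)%R -> (t q < t r)%R ->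
  l \in [:: xline i; yline j; dline e].
Proof.
move=> N Hp Hq Hr Bp Bq Br tpq tqr.
have pr : p != r by apply: contraTneq (lt_trans tpq tqr) => ->; rewrite ltxx.
(* [t] is a coordinate along [l], so [q] is the average of [p] and [r] with weights [t r - t q] and
   [t q - t p]; the affine functions defining the three sides inherit this relation. *)
have [comb1 comb2] :
    ((t r - t q) * p.1%:R + (t q - t p) * r.1%:R = (t r - t p) * q.1%:R)%R /\
    ((t r - t q) * p.2%:R + (t q - t p) * r.2%:R = (t r - t p) * q.2%:R)%R.
  rewrite /t; move: N Hp Hq Hr; rewrite /inc /normal; clear.
  case: l => [[A B] C] /=.
  case/orP => [/eqP->|/andP[/eqP-> /eqP->]] /eqP Hp /eqP Hq /eqP Hr.
    have -> : (p.1%:R = C - B * p.2%:R)%R by lra.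
    have -> : (q.1%:R = C - B * q.2%:R)%R by lra.
    have -> : (r.1%:R = C - B * r.2%:R)%R by lra.
    by split; ring.
  have -> : (p.2%:R = C)%R by lra.
  have -> : (q.2%:R = C)%R by lra.
  have -> : (r.2%:R = C)%R by lra.
  by split; ring.
have {}tpq : (0 < t q - t p)%R by rewrite subr_gt0.
have {}tqr : (0 < t r - t q)%R by rewrite subr_gt0.
have vanish (u v w : K) : (0 <= u)%R -> (0 <= v)%R -> w = 0%R ->
    ((t r - t q) * u + (t q - t p) * v = (t r - t p) * w)%R ->
    u = 0%R /\ v = 0%R.
  move=> u0 v0 ->; rewrite mulr0 => sum0.
  have U0 := mulr_ge0 (ltW tqr) u0; have V0 := mulr_ge0 (ltW tpq) v0.
  have /eqP : ((t r - t q) * u = 0)%R by lra.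
  have /eqP : ((t q - t p) * v = 0)%R by lra.
  by rewrite !mulf_eq0 (gt_eqF tpq) (gt_eqF tqr) => /eqP-> /eqP->.
case/and4P: Bp => p1 p2 p3 _; case/and4P: Br => r1 r2 r3 _.
case/and4P: Bq => _ _ _ /or3P[] /eqP Eq; rewrite !inE.
- have [] := vanish (p.1%:R - i%:R)%R (r.1%:R - i%:R)%R (q.1%:R - i%:R)%R.
  + by rewrite subr_ge0 ler_nat.
  + by rewrite subr_ge0 ler_nat.
  + by rewrite Eq subrr.
  + by rewrite !mulrBr; lra.
  move/eqP; rewrite subr_eq0 eqr_nat => /eqP Ep.
  move/eqP; rewrite subr_eq0 eqr_nat => /eqP Er.
  by rewrite (xline_through2 N Hp Hr pr Ep Er) eqxx.
- have [] := vanish (p.2%:R - j%:R)%R (r.2%:R - j%:R)%R (q.2%:R - j%:R)%R.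
  + by rewrite subr_ge0 ler_nat.
  + by rewrite subr_ge0 ler_nat.
  + by rewrite Eq subrr.
  + by rewrite !mulrBr; lra.
  move/eqP; rewrite subr_eq0 eqr_nat => /eqP Ep.
  move/eqP; rewrite subr_eq0 eqr_nat => /eqP Er.
  by rewrite (yline_through2 N Hp Hr pr Ep Er) eqxx orbT.
- have [] := vanish (e%:R - (p.1%:R + p.2%:R))%R (e%:R - (r.1%:R + r.2%:R))%R
                    (e%:R - (q.1%:R + q.2%:R))%R.
  + by rewrite -natrD subr_ge0 ler_nat.
  + by rewrite -natrD subr_ge0 ler_nat.
  + by rewrite -natrD Eq subrr.
  + by rewrite !mulrBr !mulrDr; lra.
  move/eqP; rewrite -natrD subr_eq0 eqr_nat eq_sym => /eqP Ep.
  move/eqP; rewrite -natrD subr_eq0 eqr_nat eq_sym => /eqP Er.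
  by rewrite (dline_through2 N Hp Hr pr Ep Er) eqxx !orbT.
Qed.

(** Order three points of [W] on [l] along [l]: the middle one lies on a side of the triangle, and
    [middle_on_side] makes [l] that side. *)
Lemma count_triangle_le2 (K : realFieldType) (l : line K) i j e W :
  normal l -> l \notin [:: xline i; yline j; dline e] ->
  uniq W -> all (on_triangle i j e) W -> count (inc l) W <= 2.
Proof.
move=> N lside uW /allP BW; rewrite leqNgt -size_filter; apply/negP => big.
have mem p : p \in filter (inc l) W -> inc l p /\ on_triangle i j e p.
  by rewrite mem_filter => /andP[lp /BW].
move: (filter_uniq (inc l) uW) big mem.
case: (filter (inc l) W) => [|p [|q [|r s]]] //= /and3P[].
rewrite !inE !negb_or => /and3P[pq pr _] /andP[qr _] _ _ mem.
have [lp Bp] : inc l p /\ on_triangle i j e p by apply: mem; rewrite !inE eqxx.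
have [lq Bq] : inc l q /\ on_triangle i j e q.
  by apply: mem; rewrite !inE eqxx orbT.
have [lr Br] : inc l r /\ on_triangle i j e r.
  by apply: mem; rewrite !inE eqxx !orbT.
pose t (p : nat * nat) := (l.1.2 * p.1%:R - l.1.1 * p.2%:R)%R.
(* When [l.1.1 = 1], differences of [t] on [l] are, up to sign, [l.1.2 ^+ 2 + 1] times differences
   of ordinates, so [t] separates the points of [l]. *)
have t_inj u v : inc l u -> inc l v -> u != v -> (t u < t v)%R || (t v < t u)%R.
  move=> lu lv; rewrite -neq_lt; apply: contraNneq.
  case: u v lu lv => [x y] [x' y']; rewrite /t /inc /=.
  move: N; rewrite /normal.
  case/orP => [/eqP->|/andP[/eqP-> /eqP->]] /eqP Hu /eqP Hv Et.
    have Ex : (x%:R = l.2 - l.1.2 * y%:R)%R by lra.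
    have Ex' : (x'%:R = l.2 - l.1.2 * y'%:R)%R by lra.
    have /eqP : ((l.1.2 ^+ 2 + 1) * (y%:R - y'%:R) = 0)%R.
      by move: Et; rewrite Ex Ex' => Et; rewrite !mulrBr !mulrDl; lra.
    have pos : (0 < l.1.2 ^+ 2 + 1)%R by rewrite ltr_wpDl ?sqr_ge0.
    rewrite mulf_eq0 (gt_eqF pos) subr_eq0 eqr_nat /= => /eqP Ey.
    have /eqP : (x%:R = x'%:R :> K)%R by rewrite Ex Ex' Ey.
    by rewrite eqr_nat Ey => /eqP->.
  have /eqP : (x%:R = x'%:R :> K)%R by lra.
  have /eqP : (y%:R = y'%:R :> K)%R by lra.
  by rewrite !eqr_nat => /eqP-> /eqP->.
suff : l \in [:: xline i; yline j; dline e] by rewrite (negPf lside).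
have M := @middle_on_side _ l i j e.
(* Six of the eight sign patterns order the three points; the other two are cyclic and contradict
   transitivity. *)
by case/orP: (t_inj _ _ lp lq pq) => a1; case/orP: (t_inj _ _ lq lr qr) => a2;
   case/orP: (t_inj _ _ lp lr pr) => a3;
   first [exact: (M p q r) | exact: (M p r q) | exact: (M q p r)
         |exact: (M q r p) | exact: (M r p q) | exact: (M r q p)
         |have := lt_trans a1 a2; rewrite ltNge (ltW a3)
         |have := lt_trans a2 a1; rewrite ltNge (ltW a3)].
Qed.

Definition cover (K : realFieldType) k n (L : seq (line K)) : Prop :=
  {in L, forall l, normal l} /\
  forall p, p.1 + p.2 < n -> k <= count (inc^~ p) L.

Lemma double_count (K : realFieldType) k n (L : seq (line K)) W :
  cover k n L -> all (fun p => p.1 + p.2 < n) W ->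
  k * size W <= \sum_(l <- L) count (inc l) W.
Proof.
move=> [_ cov] /allP W_in.
have -> : \sum_(l <- L) count (inc l) W = \sum_(p <- W) count (inc^~ p) L.
  under eq_bigr do rewrite -sum1_count.
  under [RHS]eq_bigr do rewrite -sum1_count.
  rewrite (exchange_big_dep xpredT) //=.
rewrite mulnC -[size W]sum1_size big_distrl /= !big_seq.
by apply: leq_sum => p /W_in /cov; rewrite mul1n.
Qed.

(* Weak linear programming duality, [W] being the dual solution. *)
Lemma weight_bound (K : realFieldType) k n c (L : seq (line K)) W
    (D F : seq (line K)) :
  cover k n L -> all (fun p => p.1 + p.2 < n) W -> uniq (D ++ F) ->
  {in L, forall l, l \notin D -> l \notin F -> count (inc l) W <= c} ->
  {in F, forall l, count (inc l) W = 0} ->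
  {in F, forall l, 2 <= count_mem l L} ->
  k * size W + c * (\sum_(l <- D) count_mem l L + 2 * size F) <=
  c * size L + \sum_(l <- D) count_mem l L * count (inc l) W.
Proof.
move=> cov W_in; rewrite cat_uniq => /and3P[uD DF uF] LW FW F2.
have countL (s : seq (line K)) (g : line K -> nat) : uniq s ->
    \sum_(l <- s) count_mem l L * g l = \sum_(l <- L) (l \in s) * g l.
  move=> us; elim: L {cov LW F2} => [|l L IH].
    by rewrite big_nil big1_seq.
  rewrite big_cons -IH /=.
  under eq_bigr do rewrite mulnDl.
  rewrite big_split /=; congr (_ + _).
  case: (boolP (l \in s)) => ls; last first.
    rewrite mul0n big1_seq // => x /andP[_ xs].
    by case: eqP ls => // ->; rewrite xs.
  rewrite (bigD1_seq l) //= eqxx big1 ?addn0 // => x xl.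
  by rewrite eq_sym (negPf xl).
have sumF : 2 * size F <= \sum_(l <- L) (l \in F).
  have -> : \sum_(l <- L) (l \in F) = \sum_(l <- F) count_mem l L.
    under [RHS]eq_bigr do rewrite -[count_mem _ _]muln1.
    by rewrite countL //; apply: eq_bigr => l _; rewrite muln1.
  rewrite mulnC -[size F]sum1_size big_distrl /= !big_seq.
  by apply: leq_sum => l /F2; rewrite mul1n.
have sumD : \sum_(l <- D) count_mem l L = \sum_(l <- L) (l \in D).
  under eq_bigr do rewrite -[count_mem _ _]muln1.
  by rewrite countL //; apply: eq_bigr => l _; rewrite muln1.
rewrite sumD countL //.
(* Adding [c] for each occurrence of a line of [D] or [F] allows a comparison line by line: a line
   of [D] gives [c] plus its count on both sides, a line of [F] gives [c], any other line at most
   [c]. *)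
apply: (@leq_trans (\sum_(l <- L) count (inc l) W +
   c * (\sum_(l <- L) (l \in D) + \sum_(l <- L) (l \in F)))).
  by rewrite leq_add ?(double_count cov) // leq_mul2l leq_add2l sumF orbT.
rewrite -big_split big_distrr -[size L]sum1_size big_distrr /= -!big_split /=.
rewrite !big_seq; apply: leq_sum => l lL.
case: (boolP (l \in D)) => lD.
  have /negPf-> : l \notin F by apply: contraNN DF => lF; apply/hasP; exists l.
  by rewrite addnC !(addn0, mul1n, muln1) leq_add2l.
case: (boolP (l \in F)) => lF; first by rewrite FW // !(add0n, addn0, muln1).
by rewrite !(addn0, muln1, muln0, mul0n) LW.
Qed.

(** * Segments and strips *)

Definition segx i lo len : seq (nat * nat) := [seq (i, y) | y <- iota lo len].
Definition segy j lo len : seq (nat * nat) := [seq (x, j) | x <- iota lo len].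
(** The subtraction is truncated, so the points are on [x + y = e] as long as [lo + len <= e.+1]. *)
Definition segz e lo len : seq (nat * nat) :=
  [seq (x, e - x) | x <- iota lo len].

Lemma mem_segx i lo len p :
  (p \in segx i lo len) = (p.1 == i) && (lo <= p.2 < lo + len).
Proof.
case: p => x y /=; apply/mapP/andP => [[t]|[/eqP-> t_in]].
  by rewrite mem_iota => ht [-> ->].
by exists y; rewrite ?mem_iota.
Qed.

Lemma mem_segy j lo len p :
  (p \in segy j lo len) = (p.2 == j) && (lo <= p.1 < lo + len).
Proof.
case: p => x y /=; apply/mapP/andP => [[t]|[/eqP-> t_in]].
  by rewrite mem_iota => ht [-> ->].
by exists x; rewrite ?mem_iota.
Qed.

Lemma mem_segz e lo len p :
  (p \in segz e lo len) = (p.2 == e - p.1) && (lo <= p.1 < lo + len).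
Proof.
case: p => x y /=; apply/mapP/andP => [[t]|[/eqP-> t_in]].
  by rewrite mem_iota => ht [-> ->].
by exists x; rewrite ?mem_iota.
Qed.

Lemma size_segx i lo len : size (segx i lo len) = len.
Proof. by rewrite size_map size_iota. Qed.

Lemma uniq_segx i lo len : uniq (segx i lo len).
Proof. by rewrite map_inj_uniq ?iota_uniq // => x y []. Qed.

Lemma uniq_segy j lo len : uniq (segy j lo len).
Proof. by rewrite map_inj_uniq ?iota_uniq // => x y []. Qed.

Lemma uniq_segz e lo len : uniq (segz e lo len).
Proof. by rewrite map_inj_uniq ?iota_uniq // => x y []. Qed.

Lemma count_iota_pred1 (a : pred nat) x lo len :
  {in iota lo len, a =1 pred1 x} -> count a (iota lo len) = (lo <= x < lo + len).
Proof. by move=> /eq_in_count->; rewrite count_uniq_mem ?iota_uniq ?mem_iota. Qed.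

Lemma count_xline_segx (K : realFieldType) a i lo len :
  count (inc (@xline K a)) (segx i lo len) = (i == a) * len.
Proof.
rewrite count_map (@eq_count _ _ (fun=> i == a)) => [|y]; last first.
  by rewrite /= inc_xline.
by case: (i == a); rewrite ?count_predT ?count_pred0 ?size_iota ?mul1n.
Qed.

Lemma count_xline_segy (K : realFieldType) a j lo len :
  count (inc (@xline K a)) (segy j lo len) = (lo <= a < lo + len).
Proof.
by rewrite count_map; apply: count_iota_pred1 => y _; rewrite /= inc_xline.
Qed.

Lemma count_xline_segz (K : realFieldType) a e lo len :
  count (inc (@xline K a)) (segz e lo len) = (lo <= a < lo + len).
Proof.
by rewrite count_map; apply: count_iota_pred1 => y _; rewrite /= inc_xline.
Qed.

Lemma count_yline_segx (K : realFieldType) b i lo len :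
  count (inc (@yline K b)) (segx i lo len) = (lo <= b < lo + len).
Proof.
by rewrite count_map; apply: count_iota_pred1 => y _; rewrite /= inc_yline.
Qed.

Lemma count_yline_segy (K : realFieldType) b j lo len :
  count (inc (@yline K b)) (segy j lo len) = (j == b) * len.
Proof.
rewrite count_map (@eq_count _ _ (fun=> j == b)) => [|y]; last first.
  by rewrite /= inc_yline.
by case: (j == b); rewrite ?count_predT ?count_pred0 ?size_iota ?mul1n.
Qed.

Lemma count_yline_segz (K : realFieldType) b e lo len : b <= e -> lo + len <= e.+1 ->
  count (inc (@yline K b)) (segz e lo len) = (lo <= e - b < lo + len).
Proof.
move=> be le; rewrite count_map; apply: count_iota_pred1 => x.
by rewrite mem_iota /= inc_yline => xb; apply/eqP/eqP => /=; lia.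
Qed.

Lemma count_dline_segx (K : realFieldType) d i lo len : i <= d ->
  count (inc (@dline K d)) (segx i lo len) = (lo <= d - i < lo + len).
Proof.
move=> id; rewrite count_map; apply: count_iota_pred1 => y _.
by rewrite /= inc_dline; apply/eqP/eqP => /=; lia.
Qed.

Lemma count_dline_segy (K : realFieldType) d j lo len : j <= d ->
  count (inc (@dline K d)) (segy j lo len) = (lo <= d - j < lo + len).
Proof.
move=> id; rewrite count_map; apply: count_iota_pred1 => y _.
by rewrite /= inc_dline; apply/eqP/eqP => /=; lia.
Qed.

Lemma count_dline_segz (K : realFieldType) d e lo len : lo + len <= e.+1 ->
  count (inc (@dline K d)) (segz e lo len) = (e == d) * len.
Proof.
move=> le; rewrite count_map (@eq_in_count _ _ (fun=> e == d)) => [|x]; last first.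
  by rewrite mem_iota /= inc_dline => xb; apply/eqP/eqP => /=; lia.
by case: (e == d); rewrite ?count_predT ?count_pred0 ?size_iota ?mul1n.
Qed.

(** With [z = n-1-x-y], [dline (n.-1 - k)] is the line [z = k], which puts the three directions on
    an equal footing. A lower index 1 instead of 0 leaves out a side of the grid, whose multiplicity
    is then counted separately. *)
Definition strips (K : realFieldType) n a0 a b0 b c0 c : seq (line K) :=
  [seq xline i | i <- iota a0 (a - a0)] ++
  [seq yline j | j <- iota b0 (b - b0)] ++
  [seq dline (n.-1 - k) | k <- iota c0 (c - c0)].
Arguments strips {K} n a0 a b0 b c0 c.

Lemma size_strips (K : realFieldType) n a0 a b0 b c0 c :
  size (@strips K n a0 a b0 b c0 c) = (a - a0) + (b - b0) + (c - c0).
Proof. by rewrite !size_cat !size_map !size_iota addnA. Qed.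

Lemma mem_strips (K : realFieldType) n a0 a b0 b c0 c (l : line K) :
  reflect [\/ exists2 i, a0 <= i < a & l = xline i,
              exists2 j, b0 <= j < b & l = yline j
            | exists2 k, c0 <= k < c & l = dline (n.-1 - k)]
          (l \in strips n a0 a b0 b c0 c).
Proof.
rewrite !mem_cat; apply: (iffP or3P); case=> [] H.
- by constructor 1; case/mapP: H => i; rewrite mem_iota => hi ->; exists i => //; lia.
- by constructor 2; case/mapP: H => i; rewrite mem_iota => hi ->; exists i => //; lia.
- by constructor 3; case/mapP: H => i; rewrite mem_iota => hi ->; exists i => //; lia.
- constructor 1; case: H => i hi ->; apply: map_f; rewrite mem_iota; lia.
- constructor 2; case: H => i hi ->; apply: map_f; rewrite mem_iota; lia.
- constructor 3; case: H => i hi ->; apply: (map_f (fun k => dline (n.-1 - k))).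
  rewrite mem_iota; lia.
Qed.

Lemma xline_strips (K : realFieldType) n a0 a b0 b c0 c i :
  (@xline K i \in strips n a0 a b0 b c0 c) = (a0 <= i < a).
Proof.
apply/mem_strips/idP => [[[j hj /xline_inj->]|[j _ /eqP]|[j _ /eqP]]|hi] //.
- by rewrite xline_eq_yline.
- by rewrite xline_eq_dline.
- by constructor 1; exists i.
Qed.

Lemma yline_strips (K : realFieldType) n a0 a b0 b c0 c j :
  (@yline K j \in strips n a0 a b0 b c0 c) = (b0 <= j < b).
Proof.
apply/mem_strips/idP => [[[i _ /eqP]|[i hi /yline_inj->]|[i _ /eqP]]|hj] //.
- by rewrite eq_sym xline_eq_yline.
- by rewrite yline_eq_dline.
- by constructor 2; exists j.
Qed.

Lemma dline_strips (K : realFieldType) n a0 a b0 b c0 c d : d < n -> c <= n ->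
  (@dline K d \in strips n a0 a b0 b c0 c) = (c0 <= n.-1 - d < c).
Proof.
move=> dn cn.
apply/mem_strips/idP => [[[i _ /eqP]|[i _ /eqP]|[i hi /dline_inj->]]|hd] //.
- by rewrite eq_sym xline_eq_dline.
- by rewrite eq_sym yline_eq_dline.
- lia.
- by constructor 3; exists (n.-1 - d) => //; congr dline; lia.
Qed.

Lemma uniq_strips (K : realFieldType) n a0 a b0 b c0 c : c <= n ->
  uniq (@strips K n a0 a b0 b c0 c).
Proof.
move=> cn; rewrite !cat_uniq.
rewrite (map_inj_uniq (@xline_inj K)) (map_inj_uniq (@yline_inj K)) !iota_uniq.
rewrite map_inj_in_uniq ?iota_uniq; last first.
  by move=> i j; rewrite !mem_iota => hi hj /dline_inj; lia.
rewrite !andbT /=; apply/andP; split; apply/hasPn => l.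
  rewrite mem_cat => /orP[] /mapP[i _ ->]; apply/mapP => -[j _ /esym/eqP].
    by rewrite xline_eq_yline.
  by rewrite xline_eq_dline.
by move=> /mapP[i _ ->]; apply/mapP => -[j _ /esym/eqP]; rewrite yline_eq_dline.
Qed.

Lemma sub_strips (K : realFieldType) n a0 a b0 b c0 c a1 a' b1 b' c1 c' :
  a1 <= a0 -> a <= a' -> b1 <= b0 -> b <= b' -> c1 <= c0 -> c <= c' ->
  {subset @strips K n a0 a b0 b c0 c <= strips n a1 a' b1 b' c1 c'}.
Proof.
move=> ha ha' hb hb' hc hc' l /mem_strips H; apply/mem_strips.
case: H => -[i hi ->]; [constructor 1|constructor 2|constructor 3];
  exists i => //; lia.
Qed.

(** [weight_bound] with the strips as [F]: points outside the strips are on none of their lines. *)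
Lemma strips_bound (K : realFieldType) k n m (L : seq (line K)) W D
    a0 a b0 b c0 c (F := strips n a0 a b0 b c0 c) :
  cover k n L -> c <= n ->
  {in F, forall l, 2 <= count_mem l L} ->
  uniq D -> {in D, forall l, l \notin F} ->
  {in W, forall p, [/\ p.1 + p.2 < n, ~~ (a0 <= p.1 < a), ~~ (b0 <= p.2 < b)
                      & ~~ (c0 <= n.-1 - (p.1 + p.2) < c)]} ->
  {in L, forall l, l \notin D -> count (inc l) W <= m} ->
  k * size W + m * (\sum_(l <- D) count_mem l L + 2 * size F) <=
  m * size L + \sum_(l <- D) count_mem l L * count (inc l) W.
Proof.
move=> cov cn F2 uD DF WF LW.
apply: (weight_bound cov) => //.
- by apply/allP => p /WF[].
- rewrite cat_uniq uD uniq_strips // andbT /=.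
  by apply/hasPn => l lF; apply/negP => /DF; rewrite lF.
- by move=> l lL lD _; apply: LW.
- move=> l /mem_strips lF; apply/eqP; rewrite -leqn0 leqNgt -has_count.
  apply/hasPn => p /WF[pn px py pz].
  case: lF => -[i hi ->]; rewrite ?(inc_xline, inc_yline, inc_dline).
  + by apply: contra px => /eqP->.
  + by apply: contra py => /eqP->.
  + by apply: contra pz => /eqP->; lia.
Qed.

(** * The cyclic symmetry of the grid, and peeling off a side *)

Definition rot (K : realFieldType) n (l : line K) : line K :=
  normalize (l.1.2 - l.1.1, - l.1.1, l.2 - l.1.1 * n.-1%:R)%R.

Lemma normal_neq0 (K : realFieldType) (l : line K) : normal l ->
  (l.1.1 != 0)%R || (l.1.2 != 0)%R.
Proof. by case/orP => [/eqP->|/andP[_ /eqP->]]; rewrite oner_eq0 ?orbT. Qed.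

(** [rot] pulls lines back along the symmetry [(x, y, z) -> (z, x, y)] of the grid; its formula
    comes from putting [(z, x)] into the equation of [l]. *)
Lemma inc_rot (K : realFieldType) n (l : line K) p : normal l -> p.1 + p.2 < n ->
  inc (rot n l) p = inc l (n.-1 - (p.1 + p.2), p.1).
Proof.
move=> /normal_neq0 nz pn; rewrite /rot inc_normalize /=.
  rewrite /inc /= natrB ?natrD; last by lia.
  by apply/eqP/eqP => H; lra.
by rewrite oppr_eq0 subr_eq0; case: (eqVneq l.1.1 0%R) nz => [->|_ _];
  rewrite ?eqxx ?orbT ?orbF.
Qed.

Lemma cover_rot (K : realFieldType) k n (L : seq (line K)) :
  cover k n L -> cover k n (map (rot n) L).
Proof.
move=> [N cov]; split=> [l /mapP[l' _ ->]|p pn]; first exact: normal_normalize.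
rewrite count_map (@eq_in_count _ _ (inc^~ (n.-1 - (p.1 + p.2), p.1))).
  by apply: cov => /=; lia.
by move=> l /N nl /=; rewrite inc_rot.
Qed.

Lemma count_rot (K : realFieldType) n (L : seq (line K)) (l l' : line K) :
  {in L, forall l, normal l} -> (forall s, normal s -> (rot n s == l) = (s == l')) ->
  count_mem l (map (rot n) L) = count_mem l' L.
Proof.
by move=> N E; rewrite count_map; apply: eq_in_count => s /N /E /=.
Qed.

Lemma rot_xline (K : realFieldType) n i (s : line K) : normal s ->
  (rot n s == xline i) = (s == yline i).
Proof.
case: s => [[A B] C]; rewrite /normal /rot /normalize /xline /yline /=.
case/orP => [/eqP->|/andP[/eqP-> /eqP->]]; last first.
  by rewrite subr0 oner_eq0 /= !xpair_eqE mul0r subr0 !divr1 oppr0 !eqxx.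
rewrite subr_eq0 !xpair_eqE oner_eq0 /=; case: (eqVneq B 1%R) => [_|B1].
  by rewrite !xpair_eqE eq_sym oner_eq0.
by rewrite !xpair_eqE mulf_eq0 oppr_eq0 oner_eq0 invr_eq0 subr_eq0 (negPf B1) andbF.
Qed.

Lemma rot_yline (K : realFieldType) n i (s : line K) : normal s -> i < n ->
  (rot n s == yline i) = (s == dline (n.-1 - i)).
Proof.
move=> N hi; move: N; have hi' : i <= n.-1 by lia.
case: s => [[A B] C]; rewrite /normal /rot /normalize /dline /yline natrB //=.
case/orP => [/eqP->|/andP[/eqP-> /eqP->]]; last first.
  by rewrite subr0 oner_eq0 /= !xpair_eqE [(0 == 1)%R]eq_sym oner_eq0.
rewrite subr_eq0 !xpair_eqE eqxx /=; case: (eqVneq B 1%R) => [_|B1].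
  rewrite !xpair_eqE !eqxx /= mul1r invrN1 mulrN1.
  by apply/eqP/eqP => H; lra.
by rewrite !xpair_eqE oner_eq0.
Qed.

Lemma rot_dline (K : realFieldType) n i (s : line K) : normal s -> i < n ->
  (rot n s == dline (n.-1 - i)) = (s == xline i).
Proof.
move=> N hi; move: N; have hi' : i <= n.-1 by lia.
case: s => [[A B] C]; rewrite /normal /rot /normalize /dline /xline natrB //=.
case/orP => [/eqP->|/andP[/eqP-> /eqP->]]; last first.
  by rewrite subr0 oner_eq0 /= !xpair_eqE oppr0 mul0r eq_sym oner_eq0 !andbF.
rewrite subr_eq0 mul1r; case: (eqVneq B 1%R) => [->|B1].
  by rewrite !xpair_eqE eq_sym oner_eq0 andbF.
rewrite !xpair_eqE eqxx /=.
have B0 : (B - 1 != 0)%R by rewrite subr_eq0.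
apply/andP/andP => [[/eqP H1 /eqP H2]|[/eqP-> /eqP->]].
  have HB : (B = 0)%R by move: (divfK B0 (-1)%R); rewrite H1; lra.
  by move: H2; rewrite HB sub0r invrN1 mulrN1 => H2; split=> //; apply/eqP; lra.
by rewrite sub0r invrN1 mulrN1 opprK; split=> //; apply/eqP; lra.
Qed.

(** The points with [x >= 1] form a grid of size [n] after a unit shift in [x], and no copy of
    [x = 0] helps to cover them. *)
Lemma cover_peel (K : realFieldType) k n (L : seq (line K)) : cover k n.+1 L ->
  exists2 L' : seq (line K), cover k n L' & size L' + count_mem (xline 0) L = size L.
Proof.
move=> [N cov].
exists [seq (l.1, l.2 - l.1.1)%R | l <- L & l != xline 0]; last first.
  by rewrite size_map size_filter addnC -(count_predC (pred1 (xline 0))).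
split=> [l /mapP[l' ]|p pn].
  by rewrite mem_filter => /andP[_ /N nl] ->; case: l' nl.
rewrite count_map count_filter.
apply: leq_trans (cov (p.1.+1, p.2) _) _; first by rewrite /=; lia.
apply: sub_count => l /= lp; apply/andP; split.
  move: lp; rewrite /inc /=; rewrite -natr1 mulrDr mulr1 => /eqP <-.
  by apply/eqP; lra.
by apply: contraTneq lp => ->; rewrite inc_xline.
Qed.

Lemma count_le1 (K : realFieldType) (l : line K) W : uniq W ->
  {in W &, forall p q, inc l p -> inc l q -> p = q} -> count (inc l) W <= 1.
Proof.
move=> uW inj; rewrite leqNgt -size_filter; apply/negP => big.
have mem p : p \in filter (inc l) W -> inc l p /\ p \in W.
  by rewrite mem_filter => /andP[].
move: (filter_uniq (inc l) uW) big mem.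
case: (filter (inc l) W) => [|p [|q s]] //= /andP[].
rewrite inE negb_or => /andP[/eqP pq _] _ _ mem; apply: pq.
have [lp Wp] : inc l p /\ p \in W by apply: mem; rewrite !inE eqxx.
have [lq Wq] : inc l q /\ q \in W by apply: mem; rewrite !inE eqxx orbT.
exact: inj.
Qed.

(** Weights on the points of [x = 0]: any other line meets this side at most once. The additive form
    avoids a truncated [k - p] for a side used [p] times. *)
Lemma cover_side (K : realFieldType) k n (L : seq (line K)) : cover k n L ->
  k * n + count_mem (xline 0) L <= size L + count_mem (xline 0) L * n.
Proof.
move=> cov.
have := @weight_bound K k n 1 L (segx 0 0 n) [:: xline 0] [::] cov.
rewrite !big_seq1 size_segx count_xline_segx !mul1n muln0 addn0; apply=> //.
- by apply/allP => p; rewrite mem_segx => /andP[/eqP-> /=].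
- move=> l /(cov.1) nl; rewrite inE => /eqP lx _.
  apply: count_le1 (uniq_segx _ _ _) _ => p q.
  rewrite !mem_segx => /andP[/eqP px _] /andP[/eqP qx _] lp lq.
  by apply: contra_notP lx => /eqP pq; apply: (xline_through2 nl lp lq pq).
Qed.

Lemma count_rot_xline (K : realFieldType) k n i (L : seq (line K)) :
  cover k n L -> count_mem (xline i) (map (rot n) L) = count_mem (yline i) L.
Proof. by case=> N _; apply: count_rot => // s; apply: rot_xline. Qed.

Lemma count_rot_yline (K : realFieldType) k n i (L : seq (line K)) :
  cover k n L -> i < n ->
  count_mem (yline i) (map (rot n) L) = count_mem (dline (n.-1 - i)) L.
Proof. by case=> N _ hi; apply: count_rot => // s ns; apply: rot_yline. Qed.

Lemma count_rot_dline (K : realFieldType) k n i (L : seq (line K)) :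
  cover k n L -> i < n ->
  count_mem (dline (n.-1 - i)) (map (rot n) L) = count_mem (xline i) L.
Proof. by case=> N _ hi; apply: count_rot => // s ns; apply: rot_dline. Qed.

(** * Bounds from triangle boundaries *)

Ltac seg_mem :=
  rewrite ?mem_cat ?mem_segx ?mem_segy ?mem_segz ?inE ?xpair_eqE /=.
Ltac seg_case :=
  repeat match goal with
  | |- is_true (_ || _) -> _ => case/orP
  | |- is_true (_ && _) -> _ => let H := fresh in case/andP => H; move: H
  | |- is_true (_ == _) -> _ => let H := fresh in move/eqP => H
  | |- is_true (_ <= _) -> _ => let H := fresh in move=> H
  end.
Ltac seg_uniq :=
  rewrite ?cat_uniq ?uniq_segx ?uniq_segy ?uniq_segz ?andbT ?andTb;
  repeat (apply/andP; split); apply/hasPn => -[x y]; seg_mem; seg_case; lia.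
Ltac seg_all :=
  apply/allP => -[x y]; seg_mem; seg_case; rewrite /on_triangle /=; lia.
(** The [match] discharges the side conditions of the [segz] counts; the loop then decides each
    remaining boolean, which leaves linear arithmetic. *)
Ltac seg_count :=
  rewrite ?count_cat ?count_xline_segx ?count_xline_segy ?count_xline_segz
    ?count_yline_segx ?count_yline_segy ?count_dline_segx ?count_dline_segy;
  try rewrite ?count_yline_segz ?count_dline_segz;
  match goal with |- is_true _ => lia | _ => idtac end;
  repeat match goal with
  | |- context [nat_of_bool ?b] =>
    first [have -> : b = true by lia | have -> : b = false by lia]
  end; rewrite /=; lia.

Lemma uniq_sides (K : realFieldType) i j e :
  uniq [:: @xline K i; yline j; dline e].
Proof.
by rewrite /= !inE xline_eq_yline xline_eq_dline yline_eq_dline.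
Qed.

Lemma side_notin_strips (K : realFieldType) n i j h a0 a b0 b c0 c :
  c <= n -> h < n -> ~~ (a0 <= i < a) -> ~~ (b0 <= j < b) -> ~~ (c0 <= h < c) ->
  {in [:: xline i; yline j; dline (n.-1 - h)],
     forall l : line K, l \notin strips n a0 a b0 b c0 c}.
Proof.
move=> cn hn hi hj hh l; rewrite !inE => /or3P[] /eqP->.
- by rewrite xline_strips.
- by rewrite yline_strips.
- by rewrite dline_strips //; lia.
Qed.

(** [strips_bound] with capacity 2, which [count_triangle_le2] justifies for every line other than
    the three sides of the triangle. *)
Lemma triangle_bound (K : realFieldType) k n (L : seq (line K)) W i j h
    a0 a b0 b c0 c (F := strips n a0 a b0 b c0 c)
    (mx := count_mem (xline i) L) (my := count_mem (yline j) L)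
    (mz := count_mem (dline (n.-1 - h)) L) :
  cover k n L -> c <= n -> h < n ->
  {in F, forall l, 2 <= count_mem l L} ->
  ~~ (a0 <= i < a) -> ~~ (b0 <= j < b) -> ~~ (c0 <= h < c) ->
  uniq W -> all (on_triangle i j (n.-1 - h)) W ->
  all (fun p => [&& ~~ (a0 <= p.1 < a), ~~ (b0 <= p.2 < b)
                  & ~~ (c0 <= n.-1 - (p.1 + p.2) < c)]) W ->
  k * size W + 2 * (mx + my + mz + 2 * ((a - a0) + (b - b0) + (c - c0))) <=
  2 * size L + mx * count (inc (@xline K i)) W + my * count (inc (@yline K j)) W +
  mz * count (inc (@dline K (n.-1 - h))) W.
Proof.
move=> cov cn hn F2 hi hj hh uW W_tri W_avoid.
have := strips_bound (W := W) (m := 2)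
  (D := [:: xline i; yline j; dline (n.-1 - h)]) cov cn F2 (uniq_sides _ _ _ _).
rewrite !big_cons !big_nil size_strips -/mx -/my -/mz !addn0 !addnA; apply.
- exact: side_notin_strips.
- move=> p pW; have /and4P[_ _ pn _] := allP W_tri p pW.
  by have /and3P[] := allP W_avoid p pW; split=> //; lia.
- by move=> l /(cov.1) nl lD; apply: count_triangle_le2 W_tri.
Qed.

(** Without the vertices each side holds [n - 2] of the [3(n - 2)] points, so
    [12(n - 2) + 12 <= 2N + 6(n - 2)]. *)
Lemma open_sides_bound (K : realFieldType) n (L : seq (line K)) :
  cover 4 n L -> 2 <= n -> count_mem (xline 0) L = 2 ->
  count_mem (yline 0) L = 2 -> count_mem (dline n.-1) L = 2 -> 3 * n <= size L.
Proof.
move=> cov n2 p0 q0 r0.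
pose W := segx 0 1 (n - 2) ++ segy 0 1 (n - 2) ++ segz n.-1 1 (n - 2).
have szW : size W = 3 * (n - 2) by rewrite !size_cat !size_map !size_iota; lia.
have W_tri : all (on_triangle 0 0 (n.-1 - 0)) W by seg_all.
have uW : uniq W by seg_uniq.
have := triangle_bound (a0 := 0) (a := 0) (b0 := 0) (b := 0) (c0 := 0) (c := 0)
  cov _ _ _ _ _ _ uW W_tri.
have -> : count (inc (@xline K 0)) W = n - 2 by seg_count.
have -> : count (inc (@yline K 0)) W = n - 2 by seg_count.
have -> : count (inc (@dline K (n.-1 - 0))) W = n - 2 by seg_count.
rewrite szW subn0 p0 q0 r0 => H.
have {}H := H ltac:(lia) ltac:(lia) ltac:(done) ltac:(lia) ltac:(lia) ltac:(lia).
have {}H := H ltac:(apply/allP => p _; lia).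
lia.
Qed.

(** Some grid point has [x <= a], [y <= b], [z <= c]. It avoids the [n - 1] double lines of smaller
    [x], [y] or [z], and three more lines pass through it. *)
Lemma point_bound (K : realFieldType) n (L : seq (line K)) a b c :
  cover 3 n L -> 0 < n <= a + b + c + 1 -> c <= n ->
  {in strips n 0 a 0 b 0 c, forall l, 2 <= count_mem l L} ->
  2 * n + 1 <= size L.
Proof.
move=> cov hn cn F2.
pose a' := minn a n.-1; pose b' := minn b (n.-1 - a'); pose c' := n.-1 - (a' + b').
have := strips_bound (W := [:: (a', b')]) (D := [::]) (m := 1) (a0 := 0) (a := a')
  (b0 := 0) (b := b') (c0 := 0) (c := c') cov.
rewrite !big_nil size_strips /= => H.
suff : 3 * 1 + 1 * (0 + 2 * (a' - 0 + (b' - 0) + (c' - 0))) <= 1 * size L + 0 by lia.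
apply: H => //; first lia.
- move=> l lF; apply: F2; apply: sub_strips lF; lia.
- by move=> p; rewrite inE => /eqP-> /=; split; lia.
- by move=> l _ _; rewrite addn0; case: (inc _ _).
Qed.

Lemma inner_bound (K : realFieldType) n (L : seq (line K)) a b c :
  cover 3 n L -> a + b + c + 2 <= n ->
  {in strips n 0 a 0 b 0 c, forall l, 2 <= count_mem l L} ->
  count_mem (xline a) L <= 1 -> count_mem (yline b) L <= 1 ->
  count_mem (dline (n.-1 - c)) L <= 1 ->
  6 * n <= 2 * size L + 2 * (a + b + c) + 3.
Proof.
move=> cov hn F2 p1 q1 r1.
pose m := n.-1 - (a + b + c).
(* Half-open segments list each vertex of the inner triangle once: [3m] points, [m + 1] on each
   side. *)
pose W := segx a b m ++ segy b a.+1 m ++ segz (n.-1 - c) a m.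
have szW : size W = 3 * m by rewrite !size_cat !size_map !size_iota; lia.
have W_tri : all (on_triangle a b (n.-1 - c)) W by seg_all.
have uW : uniq W by seg_uniq.
have W_av : all (fun p => [&& ~~ (0 <= p.1 < a), ~~ (0 <= p.2 < b)
    & ~~ (0 <= n.-1 - (p.1 + p.2) < c)]) W by seg_all.
have := triangle_bound cov _ _ F2 _ _ _ uW W_tri W_av.
have -> : count (inc (@xline K a)) W = m + 1 by seg_count.
have -> : count (inc (@yline K b)) W = m + 1 by seg_count.
have -> : count (inc (@dline K (n.-1 - c))) W = m + 1 by seg_count.
rewrite szW => H.
have {}H := H ltac:(lia) ltac:(lia) ltac:(lia) ltac:(lia) ltac:(lia).
by case: (count_mem _ L) p1 H => [|[|]] // _; case: (count_mem _ L) q1 => [|[|]] // _;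
  case: (count_mem _ L) r1 => [|[|]] // _; lia.
Qed.

(** [W] is the boundary of the grid without its vertices and without the strips; the worst
    multiplicities of the sides are 1, 2, 2. *)
Lemma light_side_bound (K : realFieldType) n (L : seq (line K)) b c :
  cover 3 n L -> 0 < b -> 0 < c -> b + c + 2 <= n ->
  {in strips n 0 0 1 b 1 c, forall l, 2 <= count_mem l L} ->
  count_mem (xline 0) L <= 1 -> count_mem (yline 0) L <= 2 ->
  count_mem (dline n.-1) L <= 2 ->
  4 * n + b + c <= 2 * size L.
Proof.
move=> cov b0 c0 hn F2 p1 q2 r2.
pose W := segx 0 b (n - b - c) ++ segy 0 1 (n.-1 - c) ++ segz n.-1 1 (n.-1 - b).
have szW : size W = (n - b - c) + (n.-1 - c) + (n.-1 - b).
  by rewrite !size_cat !size_map !size_iota; lia.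
have W_tri : all (on_triangle 0 0 (n.-1 - 0)) W by seg_all.
have uW : uniq W by seg_uniq.
have W_av : all (fun p => [&& ~~ (0 <= p.1 < 0), ~~ (1 <= p.2 < b)
    & ~~ (1 <= n.-1 - (p.1 + p.2) < c)]) W by seg_all.
have := triangle_bound cov _ _ F2 _ _ _ uW W_tri W_av.
have -> : count (inc (@xline K 0)) W = n - b - c by seg_count.
have -> : count (inc (@yline K 0)) W = n.-1 - c by seg_count.
have -> : count (inc (@dline K (n.-1 - 0))) W = n.-1 - b by seg_count.
rewrite szW subn0 => H.
have {}H := H ltac:(lia) ltac:(lia) ltac:(lia) ltac:(lia) ltac:(lia).
by case: (count_mem _ L) p1 H => [|[|]] // _;
  case: (count_mem _ L) q2 => [|[|[|]]] // _;
  case: (count_mem _ L) r2 => [|[|[|]]] // _; lia.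
Qed.

(** With all three sides used twice, [2N >= |W| + 4(a + b + c)], and [|W| >= 3n - 2(a + b + c)] even
    where a subtraction truncates. *)
Lemma outer_bound (K : realFieldType) n (L : seq (line K)) a b c :
  cover 3 n L -> 0 < a <= n -> 0 < b <= n -> 0 < c <= n ->
  {in strips n 1 a 1 b 1 c, forall l, 2 <= count_mem l L} ->
  count_mem (xline 0) L = 2 -> count_mem (yline 0) L = 2 ->
  count_mem (dline n.-1) L = 2 ->
  3 * n + 2 * (a + b + c) <= 2 * size L.
Proof.
move=> cov ha hb hc F2 p2 q2 r2.
pose W := segx 0 b (n - b - c) ++ segy 0 a (n - a - c) ++ segz n.-1 a (n - a - b).
have szW : size W = (n - b - c) + (n - a - c) + (n - a - b).
  by rewrite !size_cat !size_map !size_iota; lia.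
have W_tri : all (on_triangle 0 0 (n.-1 - 0)) W by seg_all.
have uW : uniq W by seg_uniq.
have W_av : all (fun p => [&& ~~ (1 <= p.1 < a), ~~ (1 <= p.2 < b)
    & ~~ (1 <= n.-1 - (p.1 + p.2) < c)]) W by seg_all.
have := triangle_bound cov _ _ F2 _ _ _ uW W_tri W_av.
have -> : count (inc (@xline K 0)) W = n - b - c by seg_count.
have -> : count (inc (@yline K 0)) W = n - a - c by seg_count.
have -> : count (inc (@dline K (n.-1 - 0))) W = n - a - b by seg_count.
rewrite szW subn0 p2 q2 r2 => H.
have {}H := H ltac:(lia) ltac:(lia) ltac:(lia) ltac:(lia) ltac:(lia).
lia.
Qed.

(** The cross product of [q - p] and [r - p] vanishes; moving the negative terms across makes this
    usable by [nia]. *)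
Lemma collinear_nat (K : realFieldType) (l : line K) p q r :
  normal l -> inc l p -> inc l q -> inc l r ->
  q.1 * r.2 + p.1 * q.2 + r.1 * p.2 = r.1 * q.2 + q.1 * p.2 + p.1 * r.2.
Proof.
move=> N lp lq lr; have H := collinear N lp lq lr.
by apply/eqP; rewrite -(eqr_nat K) !natrD !natrM; apply/eqP; lra.
Qed.

(** * The mixed weighting *)

Lemma count_gt1_neq (T : eqType) (a : pred T) (s : seq T) v : uniq s ->
  1 < count a s -> exists2 q, q \in s & a q && (q != v).
Proof.
move=> us; rewrite -size_filter => big.
suff /allPn[q] : ~~ all (pred1 v) (filter a s).
  by rewrite mem_filter => /andP[aq qs] qv; exists q; rewrite ?aq.
move: (filter_uniq a us) big; case: (filter a s) => [|x [|y t]] //= /andP[].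
rewrite inE negb_or => /andP[xy _] _ _; apply/negP => /and3P[/eqP xv /eqP yv _].
by rewrite xv yv eqxx in xy.
Qed.

Definition same_side (K : realFieldType) (s l : line K) : Prop :=
  forall p q, inc l p -> inc l q -> p != q -> inc s p -> inc s q -> l = s.

(* Used with [v] a vertex of the inner triangle, [E] its boundary, [s] the
   opposite side and [D] the points pushed from [s]: [l] enters the triangle at
   [v], so the points of [D] that are not on [s] are out of its reach. *)
Lemma corner_count (K : realFieldType) (l s : line K) v E D :
  normal l -> l != s -> same_side s l -> uniq E -> uniq D ->
  count (inc l) E <= 2 -> count (inc l) D <= 2 ->
  (forall q, q \in E -> inc l q -> q != v -> {in D, forall r, inc l r -> inc s r}) ->
  count (inc l) E + count (inc l) D <= 3.
Proof.
move=> N ls side uE uD E2 D2 opp.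
have [E1|E1] := leqP (count (inc l) E) 1; first exact: leq_add E1 D2.
(* Now [l] has a point of [E] besides [v], so its points in [D] all lie on [s], which it meets at
   most once. *)
have [q qE /andP[lq qv]] := count_gt1_neq v uE E1.
apply: leq_add E2 _; apply: count_le1 uD _ => r r' rD rD' lr lr'.
apply: contra_neq_eq ls => rr.
by apply: (side r r') => //; apply: (opp q qE lq qv).
Qed.

Lemma same_side_xline (K : realFieldType) (l : line K) i :
  normal l -> same_side (xline i) l.
Proof.
move=> N p q lp lq pq; rewrite !inc_xline => /eqP pi /eqP qi.
exact: xline_through2 pi qi.
Qed.

Lemma same_side_yline (K : realFieldType) (l : line K) j :
  normal l -> same_side (yline j) l.
Proof.
move=> N p q lp lq pq; rewrite !inc_yline => /eqP pi /eqP qi.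
exact: yline_through2 pi qi.
Qed.

Lemma same_side_dline (K : realFieldType) (l : line K) e :
  normal l -> same_side (dline e) l.
Proof.
move=> N p q lp lq pq; rewrite !inc_dline => /eqP pi /eqP qi.
exact: dline_through2 pi qi.
Qed.

(** A line through a vertex and a point strictly inside the angle there leaves the angle into the
    opposite one, so both coordinates change sign together. The next two lemmas treat the other two
    vertices. *)
Lemma slope_xy (K : realFieldType) (l : line K) a b q r :
  normal l -> inc l (a, b) -> inc l q -> inc l r ->
  a < q.1 -> b < q.2 -> (r.1 < a) = (r.2 < b).
Proof.
move=> N lv lq lr; have := collinear_nat N lv lq lr.
case: q r {lq lr} => [x y] [x' y'] /= H aq bq; apply/idP/idP; nia.
Qed.

Lemma slope_yz (K : realFieldType) (l : line K) u b q r :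
  normal l -> inc l (u, b) -> inc l q -> inc l r ->
  b < q.2 -> q.1 + q.2 < u + b -> (r.2 < b) = (u + b < r.1 + r.2).
Proof.
move=> N lv lq lr; have := collinear_nat N lv lq lr.
case: q r {lq lr} => [x y] [x' y'] /= H aq bq; apply/idP/idP; nia.
Qed.

Lemma slope_xz (K : realFieldType) (l : line K) a u q r :
  normal l -> inc l (a, u) -> inc l q -> inc l r ->
  a < q.1 -> q.1 + q.2 < a + u -> (r.1 < a) = (a + u < r.1 + r.2).
Proof.
move=> N lv lq lr; have := collinear_nat N lv lq lr.
case: q r {lq lr} => [x y] [x' y'] /= H aq bq; apply/idP/idP; nia.
Qed.

(** Here [n.-1 = a + b + c + m.+1], so [z = c] is [x + y = a + b + m.+1]; each vertex is listed
    once. *)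
Definition inner_rim a b m : seq (nat * nat) :=
  segx a b m.+1 ++ segy b a.+1 m.+1 ++ segz (a + b + m.+1) a m.+1.

Definition inner_corners a b m : seq (nat * nat) :=
  [:: (a, b); (a + m.+1, b); (a, b + m.+1)].

(* The points of one side of the inner triangle together with those of the
   two other sides of the grid that lie beyond it and in no double strip. *)
Definition pushed_x a b c m : seq (nat * nat) :=
  segx a b m.+2 ++ segy 0 a.+1 (b + m.+1) ++
  segz (a + b + c + m.+1) a.+1 (c + m.+1).

Definition pushed_y a b c m : seq (nat * nat) :=
  segy b a m.+2 ++ segx 0 b.+1 (a + m.+1) ++
  segz (a + b + c + m.+1) a (c + m.+1).

Definition pushed_z a b m : seq (nat * nat) :=
  segz (a + b + m.+1) a m.+2 ++ segx 0 b (a + m.+1) ++ segy 0 a (b + m.+1).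

Definition mixed_points a b c m : seq (nat * nat) :=
  inner_rim a b m ++ inner_corners a b m ++
  pushed_x a b c m ++ pushed_y a b c m ++ pushed_z a b m.

Lemma uniq_mixed a b c m : 0 < a -> 0 < b -> 0 < c ->
  [/\ uniq (inner_rim a b m), uniq (inner_corners a b m),
      uniq (pushed_x a b c m), uniq (pushed_y a b c m) & uniq (pushed_z a b m)].
Proof.
move=> a0 b0 c0; rewrite /inner_rim /pushed_x /pushed_y /pushed_z.
split; [seg_uniq| |seg_uniq|seg_uniq|seg_uniq].
have E : a + m.+1 != a by lia.
have E' : b != b + m.+1 by lia.
by rewrite /inner_corners /= !inE !xpair_eqE !negb_or !negb_and !(eq_sym a) E E' orbT.
Qed.

Lemma on_triangle_mixed a b c m :
  [/\ all (on_triangle a b (a + b + m.+1)) (inner_rim a b m),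
      all (on_triangle a 0 (a + b + c + m.+1)) (pushed_x a b c m),
      all (on_triangle 0 b (a + b + c + m.+1)) (pushed_y a b c m) &
      all (on_triangle 0 0 (a + b + m.+1)) (pushed_z a b m)].
Proof.
rewrite /inner_rim /pushed_x /pushed_y /pushed_z; split; seg_all.
Qed.

(** The rim and the three pushed lists lie on boundaries of triangles with sides among the excluded
    lines, so each holds at most 2 points of [l]: 8 in all if [l] avoids the corners. Through a
    corner, rim and opposite pushed list share at most 3, which pays for the one extra corner
    point. *)
Lemma mixed_count (K : realFieldType) (l : line K) a b c m :
  0 < a -> 0 < b -> 0 < c -> normal l ->
  l \notin [:: xline a; yline b; dline (a + b + m.+1);
               xline 0; yline 0; dline (a + b + c + m.+1)] ->
  count (inc l) (mixed_points a b c m) <= 8.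
Proof.
move=> a0 b0 c0 N; rewrite !inE !negb_or => /and5P[lx ly lz lx0 /andP[ly0 lz0]].
have [uE uC uDx uDy uDz] := uniq_mixed m a0 b0 c0.
have [tE tDx tDy tDz] := on_triangle_mixed a b c m.
(* Off [x = a], a point of [pushed_x] has exactly one of [y < b] and [z < c], whereas [slope_yz]
   makes these equivalent on [l]. *)
have outx : {in pushed_x a b c m, forall r,
    (r.1 == a) || ((r.2 < b) != (a + b + m.+1 < r.1 + r.2))}.
  by clear -a0 b0 c0; move=> [x y]; rewrite /pushed_x; seg_mem; seg_case; lia.
have outy : {in pushed_y a b c m, forall r,
    (r.2 == b) || ((r.1 < a) != (a + b + m.+1 < r.1 + r.2))}.
  by clear -a0 b0 c0; move=> [x y]; rewrite /pushed_y; seg_mem; seg_case; lia.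
have outz : {in pushed_z a b m, forall r,
    (r.1 + r.2 == a + b + m.+1) || ((r.1 < a) != (r.2 < b))}.
  by clear -a0 b0 c0; move=> [x y]; rewrite /pushed_z; seg_mem; seg_case; lia.
have E2 : count (inc l) (inner_rim a b m) <= 2.
  by apply: count_triangle_le2 tE; rewrite // !inE !negb_or lx ly.
have Dx2 : count (inc l) (pushed_x a b c m) <= 2.
  by apply: count_triangle_le2 tDx; rewrite // !inE !negb_or lx ly0.
have Dy2 : count (inc l) (pushed_y a b c m) <= 2.
  by apply: count_triangle_le2 tDy; rewrite // !inE !negb_or lx0 ly.
have Dz2 : count (inc l) (pushed_z a b m) <= 2.
  by apply: count_triangle_le2 tDz; rewrite // !inE !negb_or lx0 ly0.
have thr p q : inc l p -> inc l q -> p != q ->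
    [/\ p.1 = a -> q.1 <> a, p.2 = b -> q.2 <> b
      & p.1 + p.2 = a + b + m.+1 -> q.1 + q.2 <> a + b + m.+1].
  move=> lp lq pq; split=> hp hq.
  - by case/eqP: lx; apply: xline_through2 lp lq pq hp hq.
  - by case/eqP: ly; apply: yline_through2 lp lq pq hp hq.
  - by case/eqP: lz; apply: dline_through2 lp lq pq hp hq.
have C1 : count (inc l) (inner_corners a b m) <= 1.
  apply: count_le1 uC _ => p q pC qC lp lq; apply/eqP/negPn/negP => pq.
  have [] := thr p q lp lq pq; move: pC qC pq; rewrite !inE; clear.
  move=> /or3P[] /eqP-> /or3P[] /eqP->; rewrite ?eqxx //= => _ h1 h2 h3;
  by [apply: h1|apply: h2|apply: h3; lia].
have -> : count (inc l) (mixed_points a b c m) = count (inc l) (inner_rim a b m) +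
    (count (inc l) (inner_corners a b m) + (count (inc l) (pushed_x a b c m) +
    (count (inc l) (pushed_y a b c m) + count (inc l) (pushed_z a b m)))).
  by rewrite -!count_cat.
have [C0|] := posnP (count (inc l) (inner_corners a b m)).
  by clear -C0 E2 Dx2 Dy2 Dz2; lia.
rewrite -has_count => /hasP[v vC lv].
have rim q : q \in inner_rim a b m -> [/\ a <= q.1, b <= q.2 &
    q.1 + q.2 <= a + b + m.+1] by move/(allP tE) => /and4P[].
move: vC; rewrite !inE => /or3P[] /eqP Ev; subst v.
- have : count (inc l) (inner_rim a b m) + count (inc l) (pushed_z a b m) <= 3.
    apply: (@corner_count _ l (dline (a + b + m.+1)) (a, b)) => //.
      exact: same_side_dline.
    move=> q /rim[q1 q2 q3] lq qv r rD lr; rewrite inc_dline.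
    have [/= t1 t2 _] := thr _ _ lv lq ltac:(by rewrite eq_sym).
    have aq : a < q.1 by rewrite ltn_neqAle q1 andbT; apply/eqP => e; case: t1.
    have bq : b < q.2 by rewrite ltn_neqAle q2 andbT; apply/eqP => e; case: t2.
    by case/orP: (outz _ rD) => //; rewrite (slope_xy N lv lq lr aq bq) eqxx.
  by clear -C1 Dx2 Dy2; lia.
- have : count (inc l) (inner_rim a b m) + count (inc l) (pushed_x a b c m) <= 3.
    apply: (@corner_count _ l (xline a) (a + m.+1, b)) => //.
      exact: same_side_xline.
    move=> q /rim[q1 q2 q3] lq qv r rD lr; rewrite inc_xline.
    have [/= _ t2 t3] := thr _ _ lv lq ltac:(by rewrite eq_sym).
    have E : a + m.+1 + b = a + b + m.+1 by rewrite addnAC.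
    have bq : b < q.2 by rewrite ltn_neqAle q2 andbT; apply/eqP => e; case: t2.
    have qe : q.1 + q.2 < a + m.+1 + b.
      by rewrite E ltn_neqAle q3 andbT; apply/eqP; apply: t3.
    by case/orP: (outx _ rD) => //; rewrite -E (slope_yz N lv lq lr bq qe) eqxx.
  by clear -C1 Dz2 Dy2; lia.
- have : count (inc l) (inner_rim a b m) + count (inc l) (pushed_y a b c m) <= 3.
    apply: (@corner_count _ l (yline b) (a, b + m.+1)) => //.
      exact: same_side_yline.
    move=> q /rim[q1 q2 q3] lq qv r rD lr; rewrite inc_yline.
    have [/= t1 _ t3] := thr _ _ lv lq ltac:(by rewrite eq_sym).
    have E : a + (b + m.+1) = a + b + m.+1 by rewrite addnA.
    have aq : a < q.1 by rewrite ltn_neqAle q1 andbT; apply/eqP => e; case: t1.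
    have qe : q.1 + q.2 < a + (b + m.+1).
      by rewrite E ltn_neqAle q3 andbT; apply/eqP; apply: t3.
    by case/orP: (outy _ rD) => //; rewrite -E (slope_xz N lv lq lr aq qe) eqxx.
  by clear -C1 Dz2 Dx2; lia.
Qed.

(** Write [s = a + b + c]. With [|W| = 12m + 2s + 18], inner sides used at most once and grid sides
    twice, the count becomes [8N >= 18(m + s + 2) = 18n]. *)
Lemma mixed_bound (K : realFieldType) n (L : seq (line K)) a b c :
  cover 3 n L -> 0 < a -> 0 < b -> 0 < c -> a + b + c + 2 <= n ->
  {in strips n 0 a 0 b 0 c, forall l, 2 <= count_mem l L} ->
  count_mem (xline a) L <= 1 -> count_mem (yline b) L <= 1 ->
  count_mem (dline (n.-1 - c)) L <= 1 ->
  count_mem (xline 0) L = 2 -> count_mem (yline 0) L = 2 ->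
  count_mem (dline n.-1) L = 2 ->
  9 * n <= 4 * size L.
Proof.
move=> cov a0 b0 c0 hn F2 pa qb rc p0 q0 r0.
pose m := n - (a + b + c + 2).
have En : n.-1 = a + b + c + m.+1 by lia.
have Ec : n.-1 - c = a + b + m.+1 by lia.
move: rc r0; rewrite Ec En => rc r0.
set W := mixed_points a b c m.
pose D := [:: @xline K a; yline b; dline (a + b + m.+1);
              xline 0; yline 0; dline (a + b + c + m.+1)].
have uD : uniq D.
  have Ne : (a + b + m.+1 == a + b + c + m.+1) = false by clear -c0; lia.
  rewrite /= !inE !negb_or !(eq_sym (yline _) (xline _), eq_sym (dline _) (xline _),
    eq_sym (dline _) (yline _)).
  rewrite !xline_eq_yline !xline_eq_dline !yline_eq_dline.
  rewrite (inj_eq (@xline_inj K)) (inj_eq (@yline_inj K)) (inj_eq (@dline_inj K)).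
  by rewrite Ne (gtn_eqF a0) (gtn_eqF b0).
have szW : size W = 12 * m + 2 * (a + b + c) + 18.
  by clear; rewrite /W !size_cat !size_map !size_iota /=; lia.
(* The strips start at 1 because the sides of the grid carry points of [W] and belong to [D]. *)
have W_av : {in W, forall p, [/\ p.1 + p.2 < n, ~~ (1 <= p.1 < a), ~~ (1 <= p.2 < b)
                              & ~~ (1 <= n.-1 - (p.1 + p.2) < c)]}.
  clear -hn En a0 b0 c0; move=> [x y].
  rewrite /W /mixed_points /inner_rim /pushed_x /pushed_y /pushed_z.
  by seg_mem; rewrite En; seg_case=> *; split; lia.
have DF : {in D, forall l, l \notin strips n 1 a 1 b 1 c}.
  clear -hn En a0 b0 c0.
  move=> l; rewrite !inE => /or4P[|||/or3P[]] /eqP->;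
    rewrite ?xline_strips ?yline_strips ?dline_strips; lia.
have xa : count (inc (@xline K a)) W = 2 * m + 10.
  clear -a0 b0 c0; rewrite /W /mixed_points /inner_rim /pushed_x /pushed_y /pushed_z.
  rewrite !count_cat /= !inc_xline /=; seg_count.
have yb : count (inc (@yline K b)) W = 2 * m + 10.
  clear -a0 b0 c0; rewrite /W /mixed_points /inner_rim /pushed_x /pushed_y /pushed_z.
  rewrite !count_cat /= !inc_yline /=; seg_count.
have zc : count (inc (@dline K (a + b + m.+1))) W = 2 * m + 10.
  clear -a0 b0 c0; rewrite /W /mixed_points /inner_rim /pushed_x /pushed_y /pushed_z.
  rewrite !count_cat /= !inc_dline /=; seg_count.
have x0 : count (inc (@xline K 0)) W = 2 * a + 2 * m + 2.
  clear -a0 b0 c0; rewrite /W /mixed_points /inner_rim /pushed_x /pushed_y /pushed_z.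
  rewrite !count_cat /= !inc_xline /=; seg_count.
have y0 : count (inc (@yline K 0)) W = 2 * b + 2 * m + 2.
  clear -a0 b0 c0; rewrite /W /mixed_points /inner_rim /pushed_x /pushed_y /pushed_z.
  rewrite !count_cat /= !inc_yline /=; seg_count.
have z0 : count (inc (@dline K (a + b + c + m.+1))) W = 2 * c + 2 * m + 2.
  clear -a0 b0 c0; rewrite /W /mixed_points /inner_rim /pushed_x /pushed_y /pushed_z.
  rewrite !count_cat /= !inc_dline /=; seg_count.
have LW : {in L, forall l, l \notin D -> count (inc l) W <= 8}.
  by move=> l /(cov.1) nl lD; apply: mixed_count.
have cn : c <= n by clear -hn; lia.
have F2' : {in strips n 1 a 1 b 1 c, forall l, 2 <= count_mem l L}.
  by move=> l lF; apply: F2; apply: sub_strips lF.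
have := strips_bound cov cn F2' uD DF W_av LW.
rewrite !big_cons !big_nil size_strips p0 q0 r0 szW xa yb zc x0 y0 z0.
clear -En hn pa qb rc a0 b0 c0.
by case: (count_mem _ L) pa => [|[|]] // _; case: (count_mem _ L) qb => [|[|]] // _;
  case: (count_mem _ L) rc => [|[|]] // _; lia.
Qed.

(** * Lower bounds *)

(** If every index below [n] is heavy, [a = n] and the last clause is vacuous. *)
Lemma first_light (p : nat -> nat) n :
  exists a, [/\ a <= n, forall i, i < a -> 2 <= p i & a < n -> p a <= 1].
Proof.
elim: n => [|n [a [an heavy light]]]; first by exists 0.
have [a_lt|na] := ltnP a n; first by exists a; split=> //; [lia | move=> _; apply: light].
have Ea : a = n by lia.
subst a; have [pn|pn] := leqP (p n) 1; first by exists n.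
exists n.+1; split=> // [i|]; last by rewrite ltnn.
by rewrite ltnS leq_eqVlt => /orP[/eqP->|/heavy].
Qed.

Lemma cover_light (K : realFieldType) n (L : seq (line K)) :
  exists a b c,
    [/\ [/\ a <= n, b <= n & c <= n],
        {in strips n 0 a 0 b 0 c, forall l, 2 <= count_mem l L},
        a < n -> count_mem (xline a) L <= 1,
        b < n -> count_mem (yline b) L <= 1 &
        c < n -> count_mem (dline (n.-1 - c)) L <= 1].
Proof.
have [a [an ha la]] := first_light (fun i => count_mem (xline i) L) n.
have [b [bn hb lb]] := first_light (fun i => count_mem (yline i) L) n.
have [c [cn hc lc]] := first_light (fun i => count_mem (dline (n.-1 - i)) L) n.
exists a, b, c; split=> // l /mem_strips[] [i /andP[_ hi] ->].
- exact: ha.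
- exact: hb.
- exact: hc.
Qed.

Lemma cover_size (K : realFieldType) k n (L : seq (line K)) :
  cover k n L -> 0 < n -> k <= size L.
Proof. by case=> _ cov n0; apply: leq_trans (cov (0, 0) n0) (count_size _ _). Qed.

Lemma lower_bound3_light (K : realFieldType) n (L : seq (line K)) :
  cover 3 n L -> 0 < n -> count_mem (xline 0) L <= 1 ->
  count_mem (yline 0) L <= 2 -> count_mem (dline n.-1) L <= 2 ->
  9 * n <= 4 * size L.
Proof.
move=> cov n0 p1 q2 r2.
have [a [b [c [[_ bn cn] F2 _ lb lc]]]] := cover_light n L.
have {}F2 : {in strips n 0 0 0 b 0 c, forall l, 2 <= count_mem l L}.
  by move=> l lF; apply: F2; apply: sub_strips lF.
(* Below this threshold [inner_bound] gives [2N >= 5n - 2], or better; integrality of [N] settles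
   [n = 2] and [n = 3]. *)
have [few|many] := ltnP (2 * (b + c)) n.
  have [n1|n2] := leqP n 1; first by have := cover_size cov n0; lia.
  have := inner_bound cov _ F2 p1 (lb _) (lc _); lia.
have [n3|n4] := leqP n 3.
  by have := point_bound cov _ cn F2; lia.
(* The strips are trimmed to [b' + c' = uphalf n] with both parts positive, so that
   [2N >= 4n + uphalf n]. A width 1 is allowed even if [b] or [c] is 0, since a strip from 1 to 1 is
   empty. *)
pose c' := maxn 1 (minn c (uphalf n).-1); pose b' := uphalf n - c'.
have F2' : {in strips n 0 0 1 b' 1 c', forall l, 2 <= count_mem l L}.
  move=> l /mem_strips[] [i hi ->] //; apply: F2.
    by rewrite yline_strips; lia.
  by rewrite dline_strips; lia.
have := light_side_bound cov _ _ _ F2' p1 q2 r2; lia.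
Qed.

(** Two rotations bring the other sides to [x = 0], so it is enough to argue about [x = 0] for all
    covers of the same size. *)
Lemma cover_rot_ind (K : realFieldType) k n (L : seq (line K))
    (P : nat -> Prop) (Q : Prop) :
  (forall L' : seq (line K), cover k n L' -> size L' = size L ->
     P (count_mem (xline 0) L') \/ Q) ->
  cover k n L -> 0 < n ->
  [/\ P (count_mem (xline 0) L), P (count_mem (yline 0) L)
    & P (count_mem (dline n.-1) L)] \/ Q.
Proof.
move=> step cov n0; have cov' := cover_rot cov; have cov'' := cover_rot cov'.
have [|px|q] := step L cov; [by []| |by right].
have [|py|q] := step _ cov'; [by rewrite size_map| |by right].
have [|pz|q] := step _ cov''; [by rewrite !size_map| |by right].
left; split=> //; first by rewrite -(count_rot_xline 0 cov).
by rewrite -(subn0 n.-1) -(count_rot_yline cov n0) -(count_rot_xline 0 cov').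
Qed.

(** If [x = 0] is absent its points need distinct lines; otherwise peeling it removes at least one
    line. *)
Lemma lower_bound1 (K : realFieldType) n (L : seq (line K)) :
  cover 1 n L -> n <= size L.
Proof.
elim: n L => [//|n IH] L cov.
have := cover_side cov; have [L' /IH cov' <-] := cover_peel cov.
by case: (count_mem _ L) => [|p]; lia.
Qed.

(** A side used at most once is settled by [cover_side], one used at least three times by
    peeling. *)
Lemma lower_bound4 (K : realFieldType) n (L : seq (line K)) :
  cover 4 n L -> 3 * n <= size L.
Proof.
elim: n L => [//|n IH] L cov.
have [|//|[p2 q2 r2]|//] := cover_rot_ind (P := fun p => p = 2)
    (Q := 3 * n.+1 <= size L) _ cov.
  move=> M covM sM; have := cover_side covM; have [M' /IH covM' E] := cover_peel covM.
  rewrite -sM; have [|m2|m2] := ltngtP (count_mem (xline 0) M) 2; last by left.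
    by move=> m2 side; right; move: side m2; case: (count_mem _ _) => [|[|]] //; lia.
  by right; lia.
have [n1|n1] := leqP n.+1 1; first by have := cover_size cov (ltn0Sn n); lia.
exact: open_sides_bound.
Qed.

Lemma lower_bound3 (K : realFieldType) n (L : seq (line K)) :
  cover 3 n L -> 9 * n <= 4 * size L.
Proof.
elim: n L => [//|n IH] L cov.
have [|//|[p2 q2 r2]|//] := cover_rot_ind (P := fun p => p <= 2)
    (Q := 9 * n.+1 <= 4 * size L) _ cov.
  move=> M covM sM; have [M' /IH covM' E] := cover_peel covM.
  by have [m2|m2] := leqP (count_mem (xline 0) M) 2; [left|right; lia].
have n0 := ltn0Sn n; set N := n.+1 in cov p2 q2 r2 n0 *.
have cov' := cover_rot cov; have cov'' := cover_rot cov'.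
have rx := count_rot_xline 0 cov; have ry := count_rot_yline cov n0.
have rz := count_rot_dline cov n0; have rx' := count_rot_xline 0 cov'.
have ry' := count_rot_yline cov' n0; have rz' := count_rot_dline cov' n0.
rewrite subn0 in ry rz ry' rz'.
(* A side used at most once is rotated to [x = 0]; if there is none, all three are used exactly
   twice and the strips are nonempty. *)
have [p1|p1] := leqP (count_mem (xline 0) L) 1; first exact: lower_bound3_light.
have [q1|q1] := leqP (count_mem (yline 0) L) 1.
  rewrite -(size_map (rot N) L).
  by apply: lower_bound3_light; rewrite ?rx ?ry ?rz.
have [r1|r1] := leqP (count_mem (dline N.-1) L) 1.
  rewrite -(size_map (rot N) L) -(size_map (rot N) (map _ _)).
  by apply: lower_bound3_light; rewrite ?rx' ?ry' ?rz' ?rx ?ry ?rz.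
have [a [b [c [[an bn cn] F2 la lb lc]]]] := cover_light N L.
have a0 : 0 < a by case: a la {an F2} => // /(_ n0); lia.
have b0 : 0 < b by case: b lb {bn F2} => // /(_ n0); lia.
have c0 : 0 < c by case: c lc {cn F2} => // /(_ n0); rewrite subn0; lia.
have E2 m : m <= 2 -> 1 < m -> m = 2 by lia.
(* At this threshold the bound [3N + 2(a + b + c)] of [outer_bound] reaches [9N/2]. *)
have [big|small] := leqP (3 * N) (4 * (a + b + c)).
  have F2' : {in strips N 1 a 1 b 1 c, forall l, 2 <= count_mem l L}.
    by move=> l lF; apply: F2; apply: sub_strips lF.
  have := outer_bound cov _ _ _ F2' (E2 _ p2 p1) (E2 _ q2 q1) (E2 _ r2 r1).
  lia.
(* As [a + b + c >= 3], [small] gives [N > 4], hence [N - (a + b + c) > N/4 > 1]. *)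
have hs : a + b + c + 2 <= N by clear -a0 b0 c0 small; lia.
have [aN bN cN] : [/\ a < N, b < N & c < N] by clear -hs; split; lia.
exact: (mixed_bound cov a0 b0 c0 hs F2 (la aN) (lb bN) (lc cN)
  (E2 _ p2 p1) (E2 _ q2 q1) (E2 _ r2 r1)).
Qed.

(** * Upper bounds *)

Lemma count_strips (K : realFieldType) n a b c p : c <= n -> p.1 + p.2 < n ->
  count (inc^~ p) (@strips K n 0 a 0 b 0 c) =
  (p.1 < a) + (p.2 < b) + (n.-1 - (p.1 + p.2) < c).
Proof.
move=> cn pn; rewrite /strips !count_cat !count_map !subn0 addnA.
rewrite (@count_iota_pred1 _ p.1) => [|i _]; last by rewrite /= inc_xline eq_sym.
rewrite (@count_iota_pred1 _ p.2) => [|i _]; last by rewrite /= inc_yline eq_sym.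
rewrite (@count_iota_pred1 _ (n.-1 - (p.1 + p.2))) // => i.
by rewrite mem_iota /= inc_dline => hi; apply/eqP/eqP; lia.
Qed.

(** Superposing two families of strips takes the lines nearest to the sides twice. *)
Lemma cover_strips2 (K : realFieldType) k n a b c a' b' c' :
  c <= n -> c' <= n ->
  (forall x y z, x + y + z + 1 = n -> k <= (x < a) + (y < b) + (z < c) +
     ((x < a') + (y < b') + (z < c'))) ->
  cover k n (@strips K n 0 a 0 b 0 c ++ strips n 0 a' 0 b' 0 c').
Proof.
move=> cn cn' k_le; split=> [l|p pn].
  rewrite mem_cat => /orP[] /mem_strips[] [i _ ->];
  by rewrite /normal /= !eqxx ?orbT.
by rewrite count_cat !count_strips //; apply: k_le; lia.
Qed.

(** * From hyperplanes of the plane to lines, and the values of [f] *)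

Definition line_of (H : hyperplane 2) : line R :=
  (H.1 ord0, H.1 ord_max, H.2).

Definition hyperplane_of (l : line R) : hyperplane 2 :=
  (fun i => if i == ord0 then l.1.1 else l.1.2, l.2).

Definition coords (p : nat * nat) (i : 'I_2) : nat := if i == ord0 then p.1 else p.2.

Lemma on_hyperplaneE (H : hyperplane 2) x :
  on_hyperplane H x = inc (line_of H) (x ord0, x ord_max).
Proof.
rewrite /on_hyperplane big_ord_recr big_ord1 /=.
by rewrite (_ : widen_ord _ _ = ord0) //; apply: val_inj.
Qed.

Lemma nondegenerateE (H : hyperplane 2) :
  nondegenerate H <-> (H.1 ord0 != 0)%R || (H.1 ord_max != 0)%R.
Proof.
split=> [[[[|[|//]] hi] /=]|/orP[] H0]; [| |by exists ord0|by exists ord_max].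
  by rewrite (_ : Ordinal hi = ord0) => [->|]; last exact: val_inj.
by rewrite (_ : Ordinal hi = ord_max) => [->|]; [rewrite orbT|exact: val_inj].
Qed.

Lemma cover_of_kcover n k (L : seq (hyperplane 2)) :
  is_kcover n k L -> cover k n [seq normalize (line_of H) | H <- L].
Proof.
move=> [nd cov]; split=> [l /mapP[H _ ->]|p pn]; first exact: normal_normalize.
rewrite count_map (@eq_in_count _ _ (fun H => on_hyperplane H (coords p))).
  by apply: cov; rewrite /in_grid big_ord_recr big_ord1.
by move=> H /nd /nondegenerateE H0; rewrite /= on_hyperplaneE inc_normalize.
Qed.

Lemma kcover_of_cover n k (L : seq (line R)) :
  cover k n L -> is_kcover n k (map hyperplane_of L).
Proof.
move=> [nl cov]; split=> [H /mapP[l /nl N ->]|x xn].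
  by apply/nondegenerateE; apply: normal_neq0.
rewrite count_map (@eq_count _ _ (inc^~ (x ord0, x ord_max))).
  apply: cov; move: xn; rewrite /in_grid big_ord_recr big_ord1 /=.
  by rewrite (_ : widen_ord _ _ = ord0) //; apply: val_inj.
by move=> [[A B] C]; rewrite /= on_hyperplaneE.
Qed.

(** [L] rules out the default value of [f] and bounds it from above; normalizing an optimal family
    keeps its size and brings it under [least]. *)
Lemma f_eq n k m (L : seq (line R)) : cover k n L -> size L = m ->
  (forall L' : seq (line R), cover k n L' -> m <= size L') -> f n 2 k = m.
Proof.
move=> cov sL least; rewrite /f; case: pselect => [ex|[]]; last first.
  exists m; apply/asboolP; exists (map hyperplane_of L).
  by rewrite size_map; split=> //; apply: kcover_of_cover.
case: ex_minnP => m' /asboolP[L' [<- /cover_of_kcover cov']] min.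
apply/eqP; rewrite eqn_leq -{2}(size_map (fun H => normalize (line_of H)) L') least //.
rewrite andbT; apply: min; apply/asboolP; exists (map hyperplane_of L).
by rewrite size_map; split=> //; apply: kcover_of_cover.
Qed.

Theorem mainTheorem3 (n : nat) : (2 <= n)%nat ->
  [/\ f n 2 1 = n,
      f n 2 2 = ((3 * n).+1 %/ 2)%nat,
      f n 2 3 = ((9 * n + 3) %/ 4)%nat
    & f n 2 4 = (3 * n)%nat].
Proof.
move=> n2; split.
- apply: (@f_eq _ _ _ (strips n 0 n 0 0 0 0 ++ strips n 0 0 0 0 0 0)).
  + by apply: cover_strips2; lia.
  + by rewrite size_cat !size_strips; lia.
  + exact: lower_bound1.
(* Any two of the widths add up to at least [n], so at most one coordinate of a grid point reaches
   its width. *)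
- apply: (@f_eq _ _ _ (strips n 0 (uphalf n) 0 (uphalf n) 0 n./2 ++
      strips n 0 0 0 0 0 0)).
  + by apply: cover_strips2; lia.
  + by rewrite size_cat !size_strips; lia.
  (* A 2-cover taken twice is a 4-cover. *)
  + move=> L [nl cov]; have := @lower_bound4 R n (L ++ L).
    rewrite size_cat => H; suff : 3 * n <= size L + size L by lia.
    apply: H; split=> [l|p pn]; first by rewrite mem_cat orbb => /nl.
    by rewrite -[4]/(2 + 2) count_cat leq_add ?cov.
(* Lines of index below about [n/4] are taken twice, those up to about [n/2] once. A deficient point
   has two coordinates beyond [n/2], or one beyond [n/2] and two beyond [n/4]; the corrections by
   [r] make either sum at least [n] and the total size [9q] plus the ceiling of [9r/4]. *)
- pose q := n %/ 4; pose r := n %% 4.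
  apply: (@f_eq _ _ _ (strips n 0 (2 * q + uphalf r) 0 (2 * q + uphalf r)
        0 (2 * q + (0 < r)) ++
      strips n 0 (q + (1 < r)) 0 (q + (1 < r)) 0 q)).
  + by apply: cover_strips2; lia.
  + by rewrite size_cat !size_strips; lia.
  + have round m : 9 * n <= 4 * m -> (9 * n + 3) %/ 4 <= m by lia.
    by move=> L /lower_bound3; apply: round.
(* For odd [n], a point with [x = y = z = n./2] would be covered only three times, but it would
   force [n = 1], against [n2]. *)
- apply: (@f_eq _ _ _ (strips n 0 (uphalf n) 0 (uphalf n) 0 (uphalf n) ++
      strips n 0 n./2 0 n./2 0 n./2)).
  + by apply: cover_strips2; lia.
  + by rewrite size_cat !size_strips; lia.
  + exact: lower_bound4.
Qed.
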